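(* (i) Let $\Omega$, $a$, $f$ be as in part (I) of the context, and assume $a\in C^1(\Omega)$, $\frac{\partial a}{\partial s}>0$ on $\Omega$, and $a_+:[0,1]\to[0,\infty]$ continuous. Then $$\sigma_s\ge2\sqrt{\frac{\partial a}{\partial s}(0,0)\,\dot f(0)} .$$ (ii) In the ultra degenerate case described in part (II) of the context, the same inequality holds when $0\notin L_{td}$.
   Context: In both parts the reaction term satisfies $f\in C^1[0,1]$, $f(0)=f(1)=0$, $f>0$ on $(0,1)$. (I) Regular case. $\Omega=\{(u,s)\in\mathbb R^2: u\in[0,1],\ \omega_-(u)<s<\omega_+(u)\}$, where $\omega_+:[0,1]\to(0,\infty]$ is lower semicontinuous and $\omega_-=-\omega_+$. The flux $a:\Omega\to\mathbb R$ is continuous, $a(u,-s)=-a(u,s)$, $s\mapsto a(u,s)$ is increasing for every $u$, $a_\pm(u)=\lim_{s\to\omega_\pm(u)}a(u,s)\in[-\infty,\infty]$, and $a_+(u)=\infty$ whenever $\omega_+(u)<\infty$. For $a_-(u)<v<a_+(u)$ let $g(u,v)$ be defined by $a(u,g(u,v))=v$. Let $\mathcal H(u,V)=\frac1{g(u,V)}$ if $0<V<a_+(u)$ and $\mathcal H(u,V)=0$ if $V\ge a_+(u)$. For $\sigma\ge0$, $\mathcal V_\sigma\in C([0,1])\cap C^1((0,1))$ is the unique function, positive on $(0,1)$, with $\dot{\mathcal V}_\sigma=\sigma-f(u)\mathcal H(u,\mathcal V_\sigma)$ on $(0,1)$ and $\mathcal V_\sigma(1)=0$. $\sigma_s=\min\{\sigma\ge0:\mathcal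 V_\sigma(0)=0\}$. (II) Ultra degenerate case. $\Omega=[0,1]\times\mathbb R$, $a\in C^1([0,1]\times\mathbb R)$ with $a(u,-s)=-a(u,s)$, and $L_{td}=\{u\in[0,1]:a(u,s)=0\ \forall s\in\mathbb R\}$. It is assumed that: $L_{td}$ is the union of a finite number of intervals; $\frac{\partial a}{\partial s}(u,s)>0$ for $u\notin L_{td}$, $s\in\mathbb R$; $a(u,0)=0$ for all $u\in[0,1]$ and there is $M>0$ with $|\frac{\partial a}{\partial s}(u,s)|\le M$ for all $(u,s)$; and $a_+(u)=\lim_{s\to\infty}a(u,s)$ is continuous from $[0,1]$ to $[0,\infty]$. For $u\notin L_{td}$ and $|v|<a_+(u)$ let $g(u,v)$ be defined by $a(u,g(u,v))=v$. For $\sigma\ge0$ let $\Phi_e(u,R;\sigma)=2\sigma\sqrt R$ if $R\ge a_+(u)^2$; $=2\sqrt R\big(\sigma-\frac{f(u)}{g(u,\sqrt R)}\big)$ if $0<R<a_+(u)^2$; $=-2f(u)\frac{\partial a}{\partial s}(u,0)$ if $R\le0$ and $R<a_+(u)^2$. The problem $\dot{\mathcal R}=\Phi_e(u,\mathcal R;\sigma)$, $\mathcal R(1)=0$, has a unique Carathéodory solution $\mathcal R_\sigma\in C([0,1])$ (i.e. $\mathcal R_\sigma(u)=-\int_u^1\Phi_e(\tau,\mathcal R_\sigma(\tau);\sigma)d\tau$), and $\mathcal R_\sigma\ge0$; put $\mathcal V_\sigma=\sqrt{\mathcal R_\sigma}$. Then $\sigma_s=\min\{\sigma>0:\mathcal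 V_\sigma(0)=0\}$, understood as $+\infty$ if no such $\sigma$ exists. *)

(* Defs.v *)
From HB Require Import structures.
From mathcomp Require Import all_boot all_order all_algebra.
From mathcomp Require Import all_classical all_reals all_analysis.
Set Implicit Arguments.
Unset Strict Implicit.
Unset Printing Implicit Defensive.
Import Order.TTheory GRing.Theory Num.Theory.
Import numFieldNormedType.Exports.
Local Open Scope classical_set_scope.
Local Open Scope ring_scope.

(* Difference quotients restricted to A: one-sided at an endpoint of an
   interval A, the usual derivative at an interior point. *)
Definition derivable_in {R : realType} (A : set R) (h : R -> R) (x : R) : Prop :=
  cvg ((h y - h x) / (y - x) @[y --> within A x^']).

Definition derive_in {R : realType} (A : set R) (h : R -> R) (x : R) : R :=
  lim ((h y - h x) / (y - x) @[y --> within A x^']).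

Definition C1_on {R : realType} (A : set R) (h : R -> R) : Prop :=
  (forall x, A x -> derivable_in A h x) /\ {within A, continuous (derive_in A h)}.

(* The regions D used below are relatively open in [0,1] x R, so only the
   partial derivative in u can be one-sided (at u = 0 and u = 1). *)
Definition partial_u {R : realType} (D : set (R * R)) (a : R -> R -> R)
    (u s : R) : R :=
  derive_in [set v | D (v, s)] (a ^~ s) u.

Definition partial_s {R : realType} (a : R -> R -> R) (u s : R) : R :=
  derive1 (a u) s.

Definition C1_region {R : realType} (D : set (R * R)) (a : R -> R -> R) : Prop :=
  [/\ {within D, continuous (fun p => a p.1 p.2)},
      forall (u s : R), D (u, s) ->
        derivable_in [set v | D (v, s)] (a ^~ s) u /\ derivable (a u) s 1,
      {within D, continuous (fun p => partial_u D a p.1 p.2)} &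
      {within D, continuous (fun p => partial_s a p.1 p.2)}].

Record reaction {R : realType} (f : R -> R) : Prop := Reaction {
  reaction_C1 : C1_on `[0, 1] f ;
  reaction_0 : f 0 = 0 ;
  reaction_1 : f 1 = 0 ;
  reaction_gt0 : forall (u : R), 0 < u < 1 -> 0 < f u
}.

(* The s with (u, s) \in D and a u s = v, unique whenever a u is increasing on
   the u-section of D; 0 by convention when there is none. *)
Definition flux_inverse {R : realType} (D : set (R * R)) (a : R -> R -> R)
    (u v : R) : R :=
  xget 0 [set s | D (u, s) /\ a u s = v].

(* s --> w from below, for an extended real w; w = -oo is a junk case. *)
Definition ext_at_left {R : realType} (w : \bar R) : set_system R :=
  match w with
  | r%:E => r^'-
  | +oo%E => pinfty_nbhs R
  | -oo%E => globally set0
  end.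

(* omega stands for omega_+, and omega_- = - omega_+. *)
Definition regular_region {R : realType} (omega : R -> \bar R) : set (R * R) :=
  [set p | 0 <= p.1 <= 1 /\ (- omega p.1 < p.2%:E < omega p.1)%E].

Definition regular_aplus {R : realType} (omega : R -> \bar R) (a : R -> R -> R)
    (u : R) : \bar R :=
  lim ((a u s)%:E @[s --> ext_at_left (omega u)]).

(* As a is odd, a_- = - a_+; only a_+ enters the problem. *)
Record regular_flux {R : realType} (omega : R -> \bar R) (a : R -> R -> R) : Prop :=
  RegularFlux {
  regular_omega_gt0 : forall (u : R), 0 <= u <= 1 -> (0 < omega u)%E ;
  regular_omega_lsc :
    lower_semicontinuous (omega : subspace (`[0, 1] : set R) -> \bar R) ;
  regular_continuous :
    {within regular_region omega, continuous (fun p => a p.1 p.2)} ;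
  regular_odd : forall u s, regular_region omega (u, s) -> a u (- s) = - a u s ;
  regular_increasing : forall u s t,
    regular_region omega (u, s) -> regular_region omega (u, t) ->
    s < t -> a u s < a u t ;
  regular_aplus_pinfty : forall (u : R),
    0 <= u <= 1 -> (omega u < +oo)%E -> regular_aplus omega a u = +oo%E
}.

(* Only meaningful (and only used) for V > 0. *)
Definition regular_H {R : realType} (omega : R -> \bar R) (a : R -> R -> R)
    (u V : R) : R :=
  if (V%:E < regular_aplus omega a u)%E
  then (flux_inverse (regular_region omega) a u V)^-1 else 0.

(* V is the function V_sigma. *)
Record regular_profile {R : realType} (omega : R -> \bar R) (a : R -> R -> R)
    (f : R -> R) (sigma : R) (V : R -> R) : Prop := RegularProfile {
  regular_profile_C0 : {within `[0, 1], continuous V} ;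
  regular_profile_derivable : forall (u : R), 0 < u < 1 -> derivable V u 1 ;
  regular_profile_C1 : {within `]0, 1[, continuous (derive1 V)} ;
  regular_profile_gt0 : forall (u : R), 0 < u < 1 -> 0 < V u ;
  regular_profile_ode : forall (u : R), 0 < u < 1 ->
    derive1 V u = sigma - f u * regular_H omega a u (V u) ;
  regular_profile_1 : V 1 = 0
}.

(* {sigma >= 0 : V_sigma(0) = 0}; V_sigma is unique on [0,1], so that it is
   enough to quantify over the functions that satisfy its definition. *)
Definition regular_speeds {R : realType} (omega : R -> \bar R) (a : R -> R -> R)
    (f : R -> R) : set R :=
  [set sigma | 0 <= sigma /\
     exists2 V, regular_profile omega a f sigma V & V 0 = 0].

Definition is_min {R : realType} (S : set R) (m : R) : Prop := S m /\ lbound S m.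

Definition is_min_or_pinfty {R : realType} (S : set R) (m : \bar R) : Prop :=
  match m with
  | r%:E => is_min S r
  | +oo%E => S = set0
  | -oo%E => False
  end.

Definition degenerate_region (R : realType) : set (R * R) := `[0, 1] `*` setT.

Definition degenerate_aplus {R : realType} (a : R -> R -> R) (u : R) : \bar R :=
  lim ((a u s)%:E @[s --> +oo]).

Definition Ltd {R : realType} (a : R -> R -> R) : set R :=
  [set u | 0 <= u <= 1 /\ forall s, a u s = 0].

Record degenerate_flux {R : realType} (a : R -> R -> R) : Prop := DegenerateFlux {
  degenerate_C1 : C1_region (@degenerate_region R) a ;
  degenerate_odd : forall (u s : R), 0 <= u <= 1 -> a u (- s) = - a u s ;
  degenerate_Ltd : exists I : seq (interval R),
    Ltd a = [set u | exists2 i, i \in I & u \in i] ;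
  degenerate_partial_gt0 : forall (u s : R),
    0 <= u <= 1 -> ~ Ltd a u -> 0 < partial_s a u s ;
  degenerate_0 : forall (u : R), 0 <= u <= 1 -> a u 0 = 0 ;
  degenerate_bounded : exists2 M : R, 0 < M &
    forall (u s : R), 0 <= u <= 1 -> `|partial_s a u s| <= M ;
  degenerate_aplus_continuous : {within `[0, 1], continuous (degenerate_aplus a)}
}.

Definition Phi_e {R : realType} (a : R -> R -> R) (f : R -> R)
    (u r sigma : R) : R :=
  if (degenerate_aplus a u ^+ 2 <= r%:E)%E then 2 * sigma * Num.sqrt r
  else if 0 < r then
    2 * Num.sqrt r *
      (sigma - f u / flux_inverse (@degenerate_region R) a u (Num.sqrt r))
  else - (2 * f u * partial_s a u 0).

(* r is the function R_sigma; the final condition r 1 = 0 is the case u = 1 of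
   the integral equation. *)
Record degenerate_solution {R : realType} (a : R -> R -> R) (f : R -> R)
    (sigma : R) (r : R -> R) : Prop := DegenerateSolution {
  degenerate_solution_C0 : {within `[0, 1], continuous r} ;
  degenerate_solution_integrable : (@lebesgue_measure R).-integrable `[0, 1]
    (fun t => (Phi_e a f t (r t) sigma)%:E) ;
  degenerate_solution_eq : forall (u : R), 0 <= u <= 1 ->
    r u = - \int[@lebesgue_measure R]_(t in `[u, 1]) Phi_e a f t (r t) sigma
}.

(* {sigma > 0 : V_sigma(0) = 0} with V_sigma = sqrt R_sigma; again R_sigma is
   unique on [0,1]. *)
Definition degenerate_speeds {R : realType} (a : R -> R -> R) (f : R -> R) : set R :=
  [set sigma | 0 < sigma /\
     exists2 r, degenerate_solution a f sigma r & Num.sqrt (r 0) = 0].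

(* Main.v *)
(* If sigma < 2 sqrt(D m) with D = d_s a (0,0) and m = f'(0), choose k < D and
   m' < m such that K = k m' still satisfies sigma^2 < 4 K. By the mean value
   theorem V >= k g(u,V) near the origin, and f(u) >= m' u, so that r = V^2 (or
   r = R_sigma) is nonnegative, vanishes at 0 and satisfies
   r' <= 2 (sigma sqrt r - K u). Hence r <= B^2 u^2 improves to
   r <= (sigma B - K) u^2; starting from the a priori bound r = O(u^2),
   finitely many steps contradict r >= 0. *)
Require Import Defs.
From HB Require Import structures.
From mathcomp Require Import all_boot all_order all_algebra.
From mathcomp Require Import all_classical all_reals all_analysis.
From mathcomp Require Import ring lra.
Import Order.TTheory GRing.Theory Num.Theory.
Import numFieldNormedType.Exports.
Local Open Scope classical_set_scope.
Local Open Scope ring_scope.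

(** * Descent on quadratic bounds *)

(* The coefficient of the bound decreases at each step by at least
   K - sigma^2/4 > 0, since sigma B - K <= B^2 - (K - sigma^2/4). *)
Lemma no_quadratic_descent (R : realType) (r : R -> R) (d sigma K A : R) :
  0 < d -> 0 <= A -> sigma ^+ 2 < 4 * K ->
  (forall t, 0 <= t <= d -> 0 <= r t) ->
  (forall t, 0 <= t <= d -> r t <= A * t ^+ 2) ->
  (forall B, 0 <= B -> (forall t, 0 <= t <= d -> r t <= B ^+ 2 * t ^+ 2) ->
    forall t, 0 <= t <= d -> r t <= (sigma * B - K) * t ^+ 2) ->
  False.
Proof.
move=> d0 A0 sK r0 rA boot.
set c := K - sigma ^+ 2 / 4.
have c0 : 0 < c by rewrite /c; lra.
have step (n : nat) t : 0 <= t <= d -> r t <= (A - c *+ n) * t ^+ 2.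
  elim: n t => [|n IH] t td; first by rewrite mulr0n subr0; exact: rA.
  (* As [r d] is nonnegative, the current coefficient is too, so it is a square [B ^+ 2] and [boot]
     applies to it. *)
  have An0 : 0 <= A - c *+ n.
    have dd : 0 <= d <= d by rewrite lexx ltW.
    have := le_trans (r0 d dd) (IH d dd).
    by rewrite pmulr_lge0// exprn_gt0.
  have An := sqr_sqrtr An0; set B := Num.sqrt _ in An.
  have B0 : 0 <= B by exact: sqrtr_ge0.
  have rB s : 0 <= s <= d -> r s <= B ^+ 2 * s ^+ 2 by rewrite An; exact: IH.
  apply: (le_trans (boot B B0 rB t td)).
  apply: ler_wpM2r; first exact: sqr_ge0.
  rewrite mulrSr opprD addrA -An /c.
  have := sqr_ge0 (B - sigma / 2); nra.
have [n An] : exists n : nat, A < c *+ n.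
  exists (Num.truncn (A / c)).+1.
  by rewrite -mulr_natl -ltr_pdivrMr// truncnS_gt.
have dd : 0 <= d <= d by rewrite lexx ltW.
have := le_trans (r0 d dd) (step n d dd).
rewrite pmulr_lge0 ?exprn_gt0// subr_ge0 => /(lt_le_trans An).
by rewrite ltxx.
Qed.

(** * Flux and reaction near the origin *)

(** Moves continuity on a subspace to the neighbourhood filter of the ambient space, from which
    radii of balls can be extracted. *)
Lemma within_continuous_near (R : realType) (T : topologicalType) (A : set T)
    (h : T -> R) (x : T) (U : set R) :
  {within A, continuous h} -> A x -> nbhs (h x) U ->
  \forall y \near x, A y -> U (h y).
Proof.
move=> hc Ax hU; have := hc x _ hU.
by rewrite /nbhs/= /prop_near1 /nbhs /= -nbhs_subspace_in.
Qed.

(** [regular_aplus] is a [lim], informative only once convergence is known; monotonicity gives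
    convergence in the extended reals, and the limit then dominates every value. *)
Lemma regular_aplus_ge (R : realType) (a : R -> R -> R) (omega : R -> \bar R)
    (u t : R) :
  omega u = +oo%E -> {homo a u : s s' / s <= s'} ->
  ((a u t)%:E <= regular_aplus omega a u)%E.
Proof.
move=> ou mono; rewrite /regular_aplus ou /=.
apply: lime_ge.
  apply: nondecreasing_is_cvge => s s' ss'.
  by rewrite lee_fin; exact: mono.
near=> s; rewrite lee_fin; apply: mono.
by near: s; apply: nbhs_pinfty_ge; exact: num_real.
Unshelve. all: by end_near. Qed.

Lemma flux_inverse_eq (R : realType) (D : set (R * R)) (a : R -> R -> R)
    (u s : R) :
  D (u, s) ->
  (forall s t, D (u, s) -> D (u, t) -> s < t -> a u s < a u t) ->
  flux_inverse D a u (a u s) = s.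
Proof.
move=> Ds incr; rewrite /flux_inverse; case: xgetP => [t _ [Dt ats]|/(_ s)].
  have [ts|st|//] := ltgtP t s.
  - by have := incr _ _ Dt Ds ts; rewrite ats ltxx.
  - by have := incr _ _ Ds Dt st; rewrite ats ltxx.
by case.
Qed.

(** The mean value theorem gives [k * s <= a u s] on a small box, so a small [v] is attained at some
    [s], which is then the inverse and satisfies [k * s <= v]. Both cases rely on this, the
    degenerate one with [omega] constantly [+oo]; monotonicity is therefore asked only where
    [partial_s a u 0] is positive, which excludes the points of [Ltd a]. *)
Lemma flux_near_origin (R : realType) (omega : R -> \bar R) (a : R -> R -> R)
    (k : R) :
  let D := regular_region omega in
  (0 < omega 0%R)%E ->
  lower_semicontinuous (omega : subspace (`[0, 1] : set R) -> \bar R) ->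
  (forall u : R, 0 <= u <= 1 -> (omega u < +oo)%E ->
     regular_aplus omega a u = +oo%E) ->
  (forall u : R, 0 <= u <= 1 -> a u 0 = 0) ->
  (forall u s, D (u, s) -> derivable (a u) s 1) ->
  {within D, continuous (fun p => partial_s a p.1 p.2)} ->
  (forall u s t, 0 < partial_s a u 0 -> D (u, s) -> D (u, t) -> s < t ->
     a u s < a u t) ->
  0 < k -> k < partial_s a 0 0 ->
  exists2 d : R, 0 < d <= 1 & forall u, 0 <= u <= d ->
    k <= partial_s a u 0 /\
    forall v, 0 < v < d ->
      [/\ (v%:E < regular_aplus omega a u)%E, 0 < flux_inverse D a u v &
          k * flux_inverse D a u v <= v].
Proof.
move=> D o0 olsc apy a0 ader acont incr k0 kD.
(* [omega 0] may be infinite, so a finite level [e0] below it is fixed. Lower semicontinuity keeps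
   [omega u] above [e0] for [u] near 0 in [[0, 1]], which places a box at the origin inside [D]. *)
have [e0 e00 e0o] : exists2 e : R, 0 < e & (e%:E < omega 0%R)%E.
  case: (omega 0) o0 => [x| |]//; last by exists 1 => //; rewrite ltry.
  rewrite lte_fin => x0; exists (x / 2); first by rewrite divr_gt0.
  by rewrite lte_fin ltr_pdivrMr// ltr_pMr// ltr1n.
have I0 : (`[0, 1]%classic : set R) 0 by rewrite /= in_itv/= lexx ler01.
have [e1 /= e10 near1] : nbhs_ball (0 : R)
    [set u | `[0, 1]%classic u -> (e0%:E < omega u)%E].
  apply/nbhs_ballP.
  have [V] := olsc 0 e0 e0o.
  rewrite {1}/nbhs /= -nbhs_subspace_in// => V0 Vo.
  exact: filterS V0.
have D00 : D (0, 0).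
  rewrite /D /regular_region /= lexx ler01 oppe_lt0 o0; split => //.
have [e2 /= e20 near2] : nbhs_ball ((0, 0) : R * R)
    [set p | D p -> k < partial_s a p.1 p.2].
  apply/nbhs_ballP.
  apply: (@within_continuous_near _ _ _ (fun p => partial_s a p.1 p.2) (0, 0)
    [set z | k < z]) => //.
  exact: lt_nbhsr.
pose e := Num.min (Num.min e0 1) (Num.min e1 e2) / 2.
have e_gt0 : 0 < e by rewrite divr_gt0// !lt_min e00 ltr01 e10 e20.
have [ee0 e_1 ee1 ee2] : [/\ e < e0, e < 1, e < e1 & e < e2].
  have : e < Num.min (Num.min e0 1) (Num.min e1 e2).
    by rewrite /e ltr_pdivrMr// ltr_pMr ?ltr1n// !lt_min e00 ltr01 e10 e20.
  by rewrite !lt_min => /andP[/andP[-> ->] /andP[-> ->]].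
have I u : 0 <= u <= e -> 0 <= u <= 1.
  by move=> /andP[-> ue]; rewrite (le_trans ue)// ltW.
have ou u : 0 <= u <= e -> (e0%:E < omega u)%E.
  move=> ue; apply: near1; last by rewrite /= in_itv/= I.
  rewrite /ball /= sub0r normrN ger0_norm; last by case/andP: ue.
  by case/andP: ue => _ ue; exact: le_lt_trans ue ee1.
have Dus u s : 0 <= u <= e -> 0 <= s <= e -> D (u, s).
  move=> ue /andP[s0 se]; split => /=; first exact: I.
  have oe := ou u ue.
  apply/andP; split.
    apply: (@lt_le_trans _ _ 0%E); last by rewrite lee_fin.
    by rewrite oppe_lt0; apply: lt_trans oe; rewrite lte_fin.
  by apply: lt_trans oe; rewrite lte_fin (le_lt_trans se).
have ps u s : 0 <= u <= e -> 0 <= s <= e -> k < partial_s a u s.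
  move=> ue se; apply: (near2 (u, s)); last exact: Dus.
  case/andP: ue => u0 ue; case/andP: se => s0 se.
  split; rewrite /ball /= sub0r normrN ger0_norm//;
    by [exact: le_lt_trans ue ee2 | exact: le_lt_trans se ee2].
have zz : 0 <= (0 : R) <= e by rewrite lexx ltW.
have ee : 0 <= e <= e by rewrite lexx ltW.
have cont u : 0 <= u <= e -> {within `[0, e], continuous (a u)}.
  move=> ue; apply: derivable_within_continuous => s.
  by rewrite in_itv/= => se; apply: ader; exact: Dus.
have growth u s : 0 <= u <= e -> 0 <= s <= e -> k * s <= a u s.
  move=> ue /andP[s0 se].
  have sub x : 0 <= x <= s -> 0 <= x <= e.
    by move=> /andP[-> xs]; exact: le_trans se.
  have [x x0s| |c] := @MVT_segment R (a u) (partial_s a u) 0 s s0.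
  - have /ader/derivableP : D (u, x).
      apply: Dus => //; apply: sub.
      by move: x0s; rewrite in_itv/= => /andP[/ltW -> /ltW ->].
    by rewrite /partial_s derive1E.
  - apply: derivable_within_continuous => y.
    by rewrite in_itv/= => /sub ye; apply: ader; exact: Dus.
  - rewrite in_itv/= => /sub xe.
    rewrite a0 ?I// !subr0 => ->.
    by apply: ler_wpM2r => //; exact/ltW/ps.
(* The bound [e] keeps [u] in the box; the bound [k * e] gives [v < k * e <= a u e], so that [v] is
   attained on [[0, e]]. *)
exists (Num.min e (k * e)).
  by rewrite lt_min e_gt0 mulr_gt0//= ge_min ltW.
move=> u /andP[u0]; rewrite le_min => /andP[ue _].
have {u0} ue : 0 <= u <= e by rewrite u0.
split; first exact/ltW/ps.
have inc s t : D (u, s) -> D (u, t) -> s < t -> a u s < a u t.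
  by apply: incr; exact: lt_trans (ps u 0 ue zz).
move=> v /andP[v0]; rewrite lt_min => /andP[_ ve].
have vae : v < a u e by exact: lt_le_trans (growth u e ue ee).
have [|s] := @IVT R (a u) 0 e v (ltW e_gt0) (cont u ue).
  by rewrite a0 ?I// ge_min le_max (ltW v0) (ltW vae) orbT.
rewrite in_itv/= => se asv.
have s0 : 0 < s.
  rewrite lt_neqAle; case/andP: (se) => -> _; rewrite andbT.
  by apply/eqP => s0; move: v0; rewrite -asv -s0 a0 ?I// ltxx.
rewrite -asv flux_inverse_eq//; last exact: Dus.
split=> //; last exact: growth.
(* If [omega u] is finite then $a_+(u)=\infty$ by assumption; if it is infinite, $a_+(u)$ is at
   least [a u e], which exceeds [v]. *)
rewrite asv; case ouE : (omega u) => [x| |].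
- by rewrite apy ?ltry ?I// ouE ltry.
- apply: (@lt_le_trans _ _ (a u e)%:E); first by rewrite lte_fin.
  apply: regular_aplus_ge => // x y; rewrite le_eqVlt => /predU1P[->//|xy].
  by apply/ltW/inc => //; split; rewrite /= ?I// ouE/= ltNyr ltry.
- by have := ou u ue; rewrite ouE.
Qed.

(** Since [f 0 = 0], the difference quotient at 0 is $f(u)/u$, and its one-sided limit exceeds
    [m]. *)
Lemma reaction_near0 (R : realType) (f : R -> R) (m : R) :
  reaction f -> m < derive_in `[0, 1] f 0 ->
  exists2 d : R, 0 < d <= 1 & forall u, 0 <= u < d -> m * u <= f u.
Proof.
move=> hf mf.
have I0 : (`[0, 1]%classic : set R) 0 by rewrite /= in_itv/= lexx ler01.
have df : derivable_in `[0, 1] f 0 by case: (reaction_C1 hf) => + _; exact.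
have [e /= e0 ne] := @cvgr_gt _ _ _ _ _ _ df m mf.
exists (Num.min e 1); first by rewrite lt_min e0 ltr01 ge_min lexx orbT.
move=> u /andP[u0]; rewrite lt_min => /andP[ue u1].
have [->|un0] := eqVneq u 0; first by rewrite mulr0 (reaction_0 hf).
have up : 0 < u by rewrite lt_neqAle eq_sym un0.
have := ne u; rewrite /ball /= sub0r normrN ger0_norm// => /(_ ue un0).
rewrite in_itv/= u0 (ltW u1) (reaction_0 hf) !subr0 => /(_ isT).
by rewrite ltr_pdivlMr// => /ltW.
Qed.

(** Let $c=\sigma^2/4<Dm$. The midpoint [m'] of $c/D$ and $m$ satisfies $c/m'<D$; the midpoint [k]
    of $c/m'$ and $D$ then satisfies $c<km'$. *)
Lemma speed_margin (R : realType) (sigma D m : R) :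
  0 <= sigma -> 0 < D -> sigma < 2 * Num.sqrt (D * m) ->
  exists k m', [/\ 0 < k, k < D, 0 < m', m' < m & sigma ^+ 2 < 4 * (k * m')].
Proof.
move=> s0 D0 sDm.
(* [Num.sqrt] is 0 on nonpositive arguments; the strict inequality above a nonnegative [sigma] rules
   these out, and [m] is seen to be positive. *)
have q0 : 0 < Num.sqrt (D * m) by lra.
have Dm0 : 0 < D * m by rewrite -sqrtr_gt0.
have sq : sigma ^+ 2 / 4 < D * m.
  by have := sqr_sqrtr (ltW Dm0); set q := Num.sqrt _ in q0 sDm * => <-; nra.
set c := sigma ^+ 2 / 4 in sq *.
have c0 : 0 <= c by rewrite divr_ge0// sqr_ge0.
have m0 : 0 < m by rewrite -(pmulr_rgt0 _ D0).
have m'm : c / D < m by rewrite ltr_pdivrMr// mulrC.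
have cD0 : 0 <= c / D by rewrite divr_ge0// ltW.
pose m' := (c / D + m) / 2.
have m'0 : 0 < m' by rewrite /m'; lra.
have cm' : c / m' < D.
  by rewrite ltr_pdivrMr// mulrC -ltr_pdivrMr// /m'; lra.
have cm'0 : 0 <= c / m' by rewrite divr_ge0// ltW.
pose k := (c / m' + D) / 2.
exists k, m'; split; rewrite ?m'0//; try by [rewrite /k; lra | rewrite /m'; lra].
have : c < k * m' by rewrite -ltr_pdivrMr// /k; lra.
by rewrite /c; lra.
Qed.

(** * The regular case *)

(** Mean value theorem for [G - W]. Differentiability of [W] is asked only in the open interval,
    because the profile is merely continuous at 0. *)
Lemma le_of_derive1_le (R : realType) (W G dG : R -> R) (b : R) :
  0 <= b -> W 0 <= G 0 -> {within `[0, b], continuous W} ->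
  (forall u : R, is_derive u 1 G (dG u)) ->
  (forall u : R, 0 < u < b -> derivable W u 1 /\ derive1 W u <= dG u) ->
  W b <= G b.
Proof.
rewrite le_eqVlt => /predU1P[<-//|b0] W0 Wc Gd Wd.
have [u||c] := @MVT R (G - W) (dG - derive1 W) 0 b b0.
- rewrite in_itv/= => /Wd[/derivableP dW _].
  by rewrite !fctE derive1E; exact: is_deriveB.
- apply: within_continuousB => //; apply: derivable_within_continuous => u _.
  exact: ex_derive.
- rewrite in_itv/= !fctE => /Wd[_ ?] /eqP.
  have ? : 0 <= (dG c - derive1 W c) * (b - 0) by rewrite mulr_ge0//; lra.
  by move/eqP; lra.
Qed.

Lemma regular_speed_ge (R : realType) (f : R -> R) (omega : R -> \bar R)
    (a : R -> R -> R) (sigma : R) :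
  reaction f -> regular_flux omega a ->
  C1_region (regular_region omega) a ->
  (forall u s, regular_region omega (u, s) -> 0 < partial_s a u s) ->
  regular_speeds omega a f sigma ->
  2 * Num.sqrt (partial_s a 0 0 * derive_in `[0, 1] f 0) <= sigma.
Proof.
move=> hf ha ac apos [s0 [V hV V0]].
rewrite leNgt; apply/negP => slt.
have z1 : 0 <= (0 : R) <= 1 by rewrite lexx ler01.
have reg0 u : 0 <= u <= 1 -> regular_region omega (u, 0).
  move=> u1; split => //=; rewrite oppe_lt0.
  by rewrite (regular_omega_gt0 ha).
have [k [m [k0 kD m0 mf skm]]] :=
  @speed_margin _ _ _ _ s0 (apos _ _ (reg0 0 z1)) slt.
have [||||d1 /andP[d10 d11] flux] := @flux_near_origin R omega a k
  (regular_omega_gt0 ha z1) (regular_omega_lsc ha) (regular_aplus_pinfty ha)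
  _ _ _ _ k0 kD.
- move=> u u1; have := regular_odd ha (reg0 u u1).
  by rewrite oppr0; lra.
- by move=> u s; case: ac => _ + _ _ => /[apply] -[].
- by case: ac.
- by move=> u s t _; exact: (regular_increasing ha).
have [d2 /andP[d20 d21] fm] := @reaction_near0 R f m hf mf.
have I0 : (`[0, 1]%classic : set R) 0 by [].
have [d3 /= d30 Vd] : nbhs_ball (0 : R) [set u | `[0, 1]%classic u -> V u < d1].
  apply/nbhs_ballP.
  apply: (@within_continuous_near _ _ _ _ _ [set z | z < d1]
    (regular_profile_C0 hV)) => //.
  by rewrite V0; exact: lt_nbhsl.
pose d := Num.min (Num.min d1 d2) d3 / 2.
have d0 : 0 < d by rewrite divr_gt0// !lt_min d10 d20.
have [dd1 dd2 dd3] : [/\ d < d1, d < d2 & d < d3].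
  have : d < Num.min (Num.min d1 d2) d3.
    by rewrite ltr_pdivrMr// ltr_pMr ?ltr1n// !lt_min d10 d20.
  by rewrite !lt_min => /andP[/andP[-> ->] ->].
have ud1 u : 0 < u < d -> 0 < u < 1.
  by move=> /andP[-> ud]; rewrite (lt_le_trans ud)// (le_trans (ltW dd1)).
have Vpos u : 0 < u < d -> 0 < V u.
  by move=> /ud1; exact: (regular_profile_gt0 hV).
(* From $f(u)\ge mu$ and $k\,g(u,V)\le V$ one gets $Vf/g\ge kmu$. The first bound serves for the a
   priori estimate, the second for the descent. *)
have slope u : 0 < u < d ->
    derive1 V u <= sigma /\ V u * derive1 V u <= sigma * V u - k * m * u.
  move=> ud; have V_gt0 := Vpos _ ud; have u1 := ud1 _ ud.
  have [u0 ud'] := andP ud.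
  rewrite (regular_profile_ode hV u1).
  have [|_ /(_ (V u))[]] := flux u.
  - by rewrite ltW//= (le_trans (ltW ud'))// ltW.
  - rewrite V_gt0 Vd//.
      by rewrite /ball /= sub0r normrN gtr0_norm// (lt_trans ud').
    by rewrite /= in_itv/=; case/andP: u1 => /ltW-> /ltW->.
  rewrite /regular_H => -> g0 kg; set g := flux_inverse _ _ _ _ in g0 kg *.
  have fu : m * u <= f u by rewrite fm// ltW//= (lt_trans ud').
  have mu0 : 0 < m * u by rewrite mulr_gt0.
  have fg : m * u * k <= V u * (f u * g^-1).
    rewrite mulrA ler_pdivlMr//.
    have := ler_wpM2l (ltW mu0) kg; have := ler_wpM2l (ltW V_gt0) fu; nra.
  split; last by nra.
  by rewrite gerBl mulr_ge0// ?invr_ge0 ltW//; exact: lt_le_trans fu.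
have cV t : 0 <= t <= d -> {within `[0, t], continuous V}.
  move=> /andP[_ td]; apply: continuous_subspaceW (regular_profile_C0 hV).
  move=> x; rewrite /= !in_itv/= => /andP[-> xt] /=.
  by rewrite (le_trans xt)// (le_trans td)// (le_trans (ltW dd1)).
have sub t u : 0 <= t <= d -> 0 < u < t -> 0 < u < d.
  by move=> /andP[_ td] /andP[-> ut]; exact: lt_le_trans td.
have V_ge0 t : 0 <= t <= d -> 0 <= V t.
  move=> /andP[]; rewrite le_eqVlt => /predU1P[<-|t0 td]; first by rewrite V0.
  apply/ltW/(regular_profile_gt0 hV); rewrite t0/=.
  by rewrite (le_lt_trans td)// (lt_le_trans dd1).
have dV t u : 0 <= t <= d -> 0 < u < t -> derivable V u 1.
  by move=> td ut; exact/(regular_profile_derivable hV)/ud1/(sub t).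
(* Integrating $\dot V\le\sigma$ from $V(0)=0$ gives $V\le\sigma t$, hence the initial coefficient
   $\sigma^2$. *)
apply: (@no_quadratic_descent R (V * V) d sigma (k * m) (sigma ^+ 2)) => //.
- exact: sqr_ge0.
- by move=> t td; rewrite !fctE mulr_ge0// V_ge0.
- move=> t td; rewrite !fctE -!expr2 -exprMn ler_sqr ?nnegrE ?V_ge0//; last first.
    by rewrite mulr_ge0//; case/andP: td.
  apply: (@le_of_derive1_le R V (fun t => sigma * t) (fun=> sigma)) => //.
  + by case/andP: td.
  + by rewrite V0 mulr0.
  + exact: cV.
  + move=> u; apply: is_derive_eq; rewrite /GRing.scale/=; exact: mulr1.
  + move=> u ut; split; first exact: (dV t).
    by have [] := slope _ (sub _ _ td ut).
(* From $V\le Bu$ follows $(V^2)'=2V\dot V\le2(\sigma B-km)u$, the derivative of the improved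
   bound. *)
- move=> B B0 VB t td.
  apply: (@le_of_derive1_le R (V * V) (fun t => (sigma * B - k * m) * t ^+ 2)
    (fun u => 2 * (sigma * B - k * m) * u)) => //.
  + by case/andP: td.
  + by rewrite !fctE V0 mul0r expr0n mulr0.
  + by move=> x; apply: cvgM; exact: (cV t td).
  + move=> u; apply: is_derive_eq; rewrite /GRing.scale/=; ring.
  + move=> u ut; have /derivableP dVu := dV _ _ td ut.
    split; first exact: ex_derive.
    have ud := sub _ _ td ut.
    have -> : derive1 (V * V) u = 2 * (V u * derive1 V u).
      rewrite derive1E; apply: derive_val => //; rewrite derive1E.
      by apply: is_derive_eq; rewrite /GRing.scale/=; ring.
    have [_ sl] := slope _ ud.
    have u0 : 0 <= u by case/andP: ut => /ltW.
    have : V u <= B * u.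
      rewrite -ler_sqr ?nnegrE ?mulr_ge0 ?(ltW (Vpos _ ud))//.
      rewrite exprMn expr2; apply: VB; case/andP: ud => /ltW -> /ltW ->//.
    by nra.
Qed.

(** * The ultra degenerate case: comparison and sign of solutions *)

Lemma reaction_ge0 (R : realType) (f : R -> R) (u : R) :
  reaction f -> 0 <= u <= 1 -> 0 <= f u.
Proof.
move=> hf /andP[]; rewrite le_eqVlt => /predU1P[<-|u0]; first by rewrite (reaction_0 hf).
rewrite le_eqVlt => /predU1P[->|u1]; first by rewrite (reaction_1 hf).
by apply/ltW/(reaction_gt0 hf); rewrite u0.
Qed.

Lemma partial_s_Ltd {R : realType} {a : R -> R -> R} {u : R} (s : R) :
  Ltd a u -> partial_s a u s = 0.
Proof.
move=> [_ au]; rewrite /partial_s (_ : a u = cst 0) ?derive1_cst//.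
exact/funext.
Qed.

Section degenerate_solution_theory.
Context {R : realType} {a : R -> R -> R} {f : R -> R} {sigma : R} {r : R -> R}.
Hypothesis hr : degenerate_solution a f sigma r.

Lemma degenerate_solution_increment (x y : R) : 0 <= x -> x <= y -> y <= 1 ->
  r y - r x =
    \int[@lebesgue_measure R]_(t in `[x, y]) Phi_e a f t (r t) sigma.
Proof.
move=> x0 xy y1.
(* The boolean selects a closed or an open left end: removing [[x, y]] from [[x, 1]] leaves []y,
   1]], which is closed again at no cost to the integral. *)
have ri (b : bool) z : 0 <= z -> (@lebesgue_measure R).-integrable
    [set` Interval (BSide b z) (BRight 1)]
    (EFin \o (fun t => Phi_e a f t (r t) sigma)).
  move=> z0; apply: integrableS (degenerate_solution_integrable hr) => //.
  move=> t; rewrite /= !in_itv/= => /andP[zt ->]; rewrite andbT.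
  by apply: (le_trans z0); case: b zt => // /ltW.
rewrite !(degenerate_solution_eq hr) ?x0 ?(le_trans xy)// ?(le_trans x0)//.
have xy1 : (BLeft x <= BRight y)%O by rewrite bnd_simp.
have := Rintegral_itvB (ri true x x0) xy1.
rewrite bnd_simp => /(_ y1).
rewrite (Rintegral_itv_obnd_cbnd (ri false y (le_trans x0 xy))).
lra.
Qed.

(** A solution is known only through its integral equation, so the comparison is made between
    integrands, with [G] recovered from [dG] by the fundamental theorem of calculus. *)
Lemma degenerate_solution_le (x y : R) (G dG : R -> R) :
  0 <= x -> x <= y -> y <= 1 -> continuous dG ->
  (forall t : R, is_derive t 1 G (dG t)) ->
  (forall t, x <= t <= y -> Phi_e a f t (r t) sigma <= dG t) ->
  r y - r x <= G y - G x.
Proof.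
move=> x0; rewrite le_eqVlt => /predU1P[<-|xy y1 dGc Gd le]; first by rewrite !subrr.
have Gc t : {for t, continuous G}.
  by apply: differentiable_continuous; apply/derivable1_diffP/ex_derive.
have -> : G y - G x = \int[@lebesgue_measure R]_(t in `[x, y]) dG t.
  rewrite /Rintegral (@continuous_FTC2 _ dG G)//.
  - exact: continuous_subspaceT.
  - split => [t _| |]; first exact: ex_derive.
    + exact/cvg_at_right_filter/Gc.
    + exact/cvg_at_left_filter/Gc.
  - by move=> t _; rewrite derive1E derive_val.
rewrite degenerate_solution_increment ?(ltW xy)//.
apply: le_Rintegral => //.
- apply: integrableS (degenerate_solution_integrable hr) => //.
  move=> t; rewrite /= !in_itv/= => /andP[xt ty].
  by rewrite (le_trans x0)// (le_trans ty).
- apply: continuous_compact_integrable; first exact: segment_compact.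
  exact: continuous_subspaceT.
Qed.

Hypothesis hf : reaction f.
Hypothesis ha : degenerate_flux a.

(** A negative [x] lies below $a_+(u)^2\ge0$, so the last branch of [Phi_e] applies; there
    [partial_s a u 0] is zero on [Ltd a] and positive elsewhere. *)
Lemma Phi_e_le0 (u x : R) : 0 <= u <= 1 -> x < 0 -> Phi_e a f u x sigma <= 0.
Proof.
move=> u1 x0; rewrite /Phi_e.
have /lt_geF-> : (x%:E < degenerate_aplus a u ^+ 2)%E.
  by apply: lt_le_trans (sqre_ge0 _); rewrite lte_fin.
rewrite ltNge (ltW x0)/=.
rewrite oppr_le0 mulr_ge0// ?mulr_ge0 ?(@reaction_ge0 R f)//.
have [/(partial_s_Ltd 0)->//|au] := pselect (Ltd a u).
exact/ltW/(degenerate_partial_gt0 ha).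
Qed.

(* A solution does not increase while it is negative, so that it could not
   come back to r 1 = 0. *)
Lemma degenerate_solution_ge0 (u : R) : 0 <= u <= 1 -> 0 <= r u.
Proof.
move=> /andP[u0 u1]; rewrite leNgt; apply/negP => ru.
have r1 : r 1 = 0.
  by rewrite (degenerate_solution_eq hr) ?ler01 ?lexx// set_itv1 Rintegral_set1 oppr0.
(* The infimum [w] of [S] is where [r] first ceases to be negative after [u]. If [r w] were
   negative, continuity would keep [r] negative close to [w], where [S] has points. *)
pose S := [set t | u <= t <= 1 /\ 0 <= r t].
have S1 : S 1 by rewrite /S /= u1 lexx r1.
have Slb : lbound S u by move=> t [/andP[]].
have Sinf : has_inf S by split; [exists 1 | exists u].
have Sge t : S t -> inf S <= t by apply: ge_inf; exists u.
set w := inf S in Sge.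
have uw : u <= w by apply: lb_le_inf => //; exists 1.
have w1 : w <= 1 by exact: Sge.
have neg t : u <= t -> t < w -> r t < 0.
  move=> ut tw; rewrite ltNge; apply/negP => rt.
  have /Sge : S t by rewrite /S /= ut rt (le_trans (ltW tw)).
  by rewrite leNgt tw.
have [rw|rw] := ltP (r w) 0.
  have Iw : (`[0, 1]%classic : set R) w by rewrite /= in_itv/= (le_trans u0).
  have [e /= e0 re] : nbhs_ball w [set t | `[0, 1]%classic t -> r t < 0].
    apply/nbhs_ballP.
    apply: (@within_continuous_near _ _ _ _ _ [set z | z < 0]
      (degenerate_solution_C0 hr)) => //.
    exact: lt_nbhsl.
  have [t St tw] := inf_adherent e0 Sinf.
  have wt := Sge t St.
  case: St => /andP[ut t1]; rewrite leNgt => /negP; apply.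
  apply: re.
    by rewrite /ball /= distrC ger0_norm ?subr_ge0// ltrBlDl.
  by rewrite /= in_itv/= t1 (le_trans u0).
have rc : {within `[u, w], continuous r}.
  apply: continuous_subspaceW (degenerate_solution_C0 hr) => t.
  by rewrite /= !in_itv/= => /andP[ut tw]; rewrite (le_trans u0)// (le_trans tw).
(* Before [w] the solution would have to climb to the value [r u / 2 > r u] at some [c]. Stopping at
   [c < w] keeps [r] negative on all of [[u, c]], where it cannot increase. *)
have [|c] := @IVT R r u w (r u / 2) uw rc.
  by rewrite ge_min le_max; apply/andP; split; apply/orP; [left|right]; lra.
rewrite in_itv/= => /andP[uc cw] rcu.
have {}cw : c < w.
  by rewrite lt_neqAle cw andbT; apply/eqP => cw'; move: rw; rewrite -cw'; lra.
have := @degenerate_solution_le u c (cst 0) (cst 0) u0 uc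
  (ltW (lt_le_trans cw w1)) (fun x => cvg_cst _) (fun t => is_derive_cst _ _ _).
rewrite subrr rcu => H; have {H} : r u / 2 - r u <= 0.
  apply: H => t /andP[ut tc]; apply: Phi_e_le0.
    by rewrite (le_trans u0)//= (le_trans tc)// (le_trans (ltW cw)).
  by apply: neg => //; exact: le_lt_trans cw.
lra.
Qed.

End degenerate_solution_theory.

(** * The ultra degenerate case: estimates near the origin and the speed bound *)

Lemma degenerate_regionE (R : realType) :
  @degenerate_region R = regular_region (fun=> +oo%E).
Proof.
apply/seteqP; split => [[u s]|[u s]]; rewrite /regular_region /degenerate_region /=.
  by move=> []/=; rewrite in_itv/= ltNyr ltry.
by move=> [u1 _]; rewrite in_itv.
Qed.

(** Near the origin $\sqrt x<a_+(u)$, which excludes the first branch. For $x>0$ the bound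
    $kg\le\sqrt x$ gives $\sqrt x\,f/g\ge kmu$; for $x=0$ it suffices that $\partial_s a(u,0)\ge
    k$. *)
Lemma Phi_e_near_origin (R : realType) (a : R -> R -> R) (f : R -> R)
    (k m : R) :
  reaction f -> degenerate_flux a -> ~ Ltd a 0 ->
  0 < k -> k < partial_s a 0 0 -> 0 < m -> m < derive_in `[0, 1] f 0 ->
  exists2 d : R, 0 < d <= 1 & forall u x sigma : R,
    0 <= u < d -> 0 <= x < d ^+ 2 ->
    Phi_e a f u x sigma <= 2 * (sigma * Num.sqrt x - k * m * u).
Proof.
move=> hf ha a0 k0 kD m0 mf.
have apE u : degenerate_aplus a u = regular_aplus (fun=> +oo%E) a u by [].
have [C1a1 C1a2 _ C1a4] := degenerate_C1 ha.
rewrite degenerate_regionE in C1a2 C1a4.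
have [||||||d1 /andP[d10 d11] flux] :=
  @flux_near_origin R (fun=> +oo%E) a k _ _ _ _ _ C1a4 _ k0 kD.
- exact: ltry.
- by move=> u x _; exists setT => [|y _]; [exact: filterT | exact: ltry].
- by move=> u _; rewrite ltxx.
- by move=> u; exact: (degenerate_0 ha).
- by move=> u s /C1a2[].
(* Since [partial_s a] vanishes over [Ltd a], its positivity at [(u, 0)] puts [u] outside [Ltd a],
   where [a u] has positive derivative everywhere. *)
- move=> u s t au Ds Dt st.
  have u1 : 0 <= u <= 1 by case: Ds.
  have Lu : ~ Ltd a u by move=> /(partial_s_Ltd 0) au0; rewrite au0 ltxx in au.
  have D v : regular_region (fun=> +oo%E) (u, v).
    by rewrite -degenerate_regionE; split; rewrite //= in_itv.
  apply: (@gtr0_derive1_lt_cc R (a u) s t) => //.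
  + by move=> v _; have [] := C1a2 _ _ (D v).
  + by move=> v _; exact: (degenerate_partial_gt0 ha).
  + apply: derivable_within_continuous => v _.
    by have [] := C1a2 _ _ (D v).
  + by rewrite in_itv/= lexx ltW.
  + by rewrite in_itv/= lexx ltW.
have [d2 /andP[d20 d21] fm] := @reaction_near0 R f m hf mf.
exists (Num.min d1 d2); first by rewrite lt_min d10 d20 ge_min d11.
move=> u x sigma /andP[u0]; rewrite lt_min => /andP[ud1 ud2] /andP[x0 xd].
have fu : m * u <= f u by rewrite fm// u0.
have [|pk ap] := flux u; first by rewrite u0 ltW.
set q := Num.sqrt x.
have q0 : 0 <= q by exact: sqrtr_ge0.
have qq : q ^+ 2 = x by exact: sqr_sqrtr.
have qd1 : q < d1.
  have dd0 : 0 < Num.min d1 d2 by rewrite lt_min d10.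
  have : q < Num.min d1 d2 by rewrite -ltr_sqr ?nnegrE ?(ltW dd0)// qq.
  by rewrite lt_min => /andP[].
have qap : (q%:E < degenerate_aplus a u)%E.
  (* [flux] needs a positive argument and [q] may be 0, so the midpoint of [q] and [d1] is used. *)
  rewrite apE; apply: (@le_lt_trans _ _ ((q + d1) / 2)%:E).
    by rewrite lee_fin; lra.
  by have [] := ap ((q + d1) / 2) ltac:(apply/andP; split; lra).
have xap : (x%:E < degenerate_aplus a u ^+ 2)%E.
  by rewrite -qq EFin_expe lte_sqr ?lee_fin//; apply: ltW; apply: le_lt_trans qap.
rewrite /Phi_e (lt_geF xap).
have [xp|xn] := ltP 0 x; last first.
  have -> : q = 0 by apply/eqP; rewrite sqrtr_eq0.
  have mu : 0 <= m * u by rewrite mulr_ge0// ltW.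
  by nra.
have qp : 0 < q by rewrite sqrtr_gt0.
have [|_ g0 kg] := ap q; first by rewrite qp.
rewrite degenerate_regionE -/q.
set g := flux_inverse _ _ _ _ in g0 kg *.
have mu : 0 <= m * u by rewrite mulr_ge0// ltW.
have fg : m * u * k <= q * (f u * g^-1).
  rewrite mulrA ler_pdivlMr//.
  have := ler_wpM2l mu kg; have := ler_wpM2l q0 fu; nra.
nra.
Qed.

Lemma degenerate_speed_ge (R : realType) (f : R -> R) (a : R -> R -> R)
    (sigma : R) :
  reaction f -> degenerate_flux a -> ~ Ltd a 0 ->
  degenerate_speeds a f sigma ->
  2 * Num.sqrt (partial_s a 0 0 * derive_in `[0, 1] f 0) <= sigma.
Proof.
move=> hf ha a0 [s0 [r hr r0]].
rewrite leNgt; apply/negP => slt.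
have z1 : 0 <= (0 : R) <= 1 by rewrite lexx ler01.
have [k [m [k0 kD m0 mf skm]]] :=
  @speed_margin _ _ _ _ (ltW s0) (degenerate_partial_gt0 ha 0 z1 a0) slt.
(* A vanishing [Num.sqrt] says only [r 0 <= 0]; the sign of solutions supplies the other
   inequality. *)
have {r0} r0 : r 0 = 0.
  apply/eqP; rewrite eq_le (degenerate_solution_ge0 hr)// andbT -sqrtr_eq0.
  exact/eqP.
have [d1 /andP[d10 d11] Phi] := @Phi_e_near_origin R a f k m hf ha a0 k0 kD m0 mf.
have I0 : (`[0, 1]%classic : set R) 0 by [].
have [d2 /= d20 rd] :
    nbhs_ball (0 : R) [set u | `[0, 1]%classic u -> r u < d1 ^+ 2].
  apply/nbhs_ballP.
  apply: (@within_continuous_near _ _ _ _ _ [set z | z < d1 ^+ 2]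
    (degenerate_solution_C0 hr)) => //.
  by rewrite r0; apply: lt_nbhsl; rewrite exprn_gt0.
pose d := Num.min d1 d2 / 2.
have d0 : 0 < d by rewrite divr_gt0// !lt_min d10 d20.
have [dd1 dd2] : d < d1 /\ d < d2.
  have : d < Num.min d1 d2.
    by rewrite ltr_pdivrMr// ltr_pMr ?ltr1n// !lt_min d10 d20.
  by rewrite !lt_min => /andP[-> ->].
have sub t : 0 <= t <= d -> 0 <= t <= 1.
  by move=> /andP[-> td]; rewrite (le_trans td)// (le_trans (ltW dd1)).
have r_ge0 t : 0 <= t <= d -> 0 <= r t.
  by move=> /sub; exact: (degenerate_solution_ge0 hr).
have Phid t : 0 <= t <= d ->
    Phi_e a f t (r t) sigma <= 2 * (sigma * Num.sqrt (r t) - k * m * t).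
  move=> td; have [t0 td'] := andP td.
  apply: Phi; first by rewrite t0 (le_lt_trans td').
  rewrite r_ge0// rd//; last by rewrite /= in_itv/= sub.
  by rewrite /ball /= sub0r normrN ger0_norm// (le_lt_trans td').
have km0 : 0 < k * m by rewrite mulr_gt0.
apply: (@no_quadratic_descent R r d sigma (k * m) ((2 * sigma) ^+ 2)) => //.
- exact: sqr_ge0.
- move=> t td; have [t0 td'] := andP td; have /andP[_ t1] := sub _ td.
  have rc : {within `[0, t], continuous r}.
    apply: continuous_subspaceW (degenerate_solution_C0 hr) => u.
    by rewrite /= !in_itv/= => /andP[-> ut]; rewrite (le_trans ut).
  (* A priori bound: let [q ^+ 2] be the maximum of [r] on [[0, t]], attained at [c]. There [Phi_e]
     is at most $2\sigma q$, so $q^2\le2\sigma qc$ and $q\le2\sigma t$. *)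
  have [c] := @EVT_max R r 0 t t0 rc.
  rewrite in_itv/= => /andP[c0 ct] cmax.
  have cd : 0 <= c <= d by rewrite c0 (le_trans ct).
  apply: (le_trans (cmax t _)); first by rewrite in_itv/= t0 lexx.
  pose q := Num.sqrt (r c).
  have q0 : 0 <= q by exact: sqrtr_ge0.
  have qq : q ^+ 2 = r c by rewrite sqr_sqrtr// r_ge0.
  have : r c - r 0 <= 2 * sigma * q * c - 2 * sigma * q * 0.
    apply: (@degenerate_solution_le R a f sigma r hr 0 c
      (fun u => 2 * sigma * q * u) (cst (2 * sigma * q))) => //.
    + exact: le_trans ct t1.
    + by move=> u; exact: cvg_cst.
    + by move=> u; apply: is_derive_eq; rewrite /GRing.scale/=; ring.
    + move=> u /andP[u0 uc]; apply: le_trans (Phid u _) _.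
        by rewrite u0 (le_trans uc)//; case/andP: cd.
      have : Num.sqrt (r u) <= q.
        by apply: ler_wsqrtr; apply: cmax; rewrite in_itv/= u0 (le_trans uc).
      have : 0 <= k * m * u by rewrite mulr_ge0// ltW.
      by rewrite /=; nra.
  rewrite r0 subr0 mulr0 subr0 -qq => qc.
  have qt : q <= 2 * sigma * t.
    rewrite leNgt; apply/negP => tq.
    have : 2 * sigma * c <= 2 * sigma * t by rewrite ler_wpM2l// mulr_ge0// ltW.
    have : 0 <= 2 * sigma * c by rewrite !mulr_ge0// ltW.
    nra.
  by rewrite -exprMn ler_sqr ?nnegrE//; exact: le_trans qt.
(* With $\sqrt r\le Bu$ the bound on [Phi_e] becomes $2(\sigma B-km)u$, the derivative of the
   improved quadratic. *)
- move=> B B0 rB t td; have [t0 td'] := andP td; have /andP[_ t1] := sub _ td.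
  suff : r t - r 0 <= (sigma * B - k * m) * t ^+ 2 - (sigma * B - k * m) * 0 ^+ 2.
    by rewrite r0 expr0n/= mulr0 !subr0.
  apply: (@degenerate_solution_le R a f sigma r hr 0 t
    (fun u => (sigma * B - k * m) * u ^+ 2)
    (fun u => 2 * (sigma * B - k * m) * u)) => //.
  + exact: mulrl_continuous.
  + by move=> u; apply: is_derive_eq; rewrite /GRing.scale/=; ring.
  + move=> u /andP[u0 ut].
    have ud : 0 <= u <= d by rewrite u0 (le_trans ut).
    apply: le_trans (Phid u ud) _.
    have : Num.sqrt (r u) <= B * u.
      rewrite -ler_sqr ?nnegrE ?sqrtr_ge0 ?mulr_ge0// sqr_sqrtr ?r_ge0//.
      by rewrite exprMn; exact: rB.
    nra.
Qed.

Theorem corollaryA2 (R : realType) (f : R -> R) (hf : reaction f) :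
  (forall (omega : R -> \bar R) (a : R -> R -> R) (sigma_s : R),
     regular_flux omega a ->
     C1_region (regular_region omega) a ->
     (forall u s, regular_region omega (u, s) -> 0 < partial_s a u s) ->
     {within `[0, 1], continuous (regular_aplus omega a)} ->
     is_min (regular_speeds omega a f) sigma_s ->
     2 * Num.sqrt (partial_s a 0 0 * derive_in `[0, 1] f 0) <= sigma_s)
  /\
  (forall (a : R -> R -> R) (sigma_s : \bar R),
     degenerate_flux a ->
     ~ Ltd a 0 ->
     is_min_or_pinfty (degenerate_speeds a f) sigma_s ->
     ((2 * Num.sqrt (partial_s a 0 0 * derive_in `[0, 1] f 0))%:E <= sigma_s)%E).
Proof.
split=> [omega a sigma_s ha ac apos _ [hs _]|a sigma_s ha a0].
  exact: (@regular_speed_ge R f omega a).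
case: sigma_s => [s [hs _]| |//]; last by rewrite leey.
by rewrite lee_fin; exact: (@degenerate_speed_ge R f a).
Qed.
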